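(* Let $p$ be a prime, $r\ge1$, and $1\le d\le p^r$. Let $I,J\in\binom{\mathbb{Z}_{p^r}}{d}$. If the $J$-th Plücker coordinate of the $I$-th representation of $\mathbb{Z}_{p^r}$ is zero, then at least two (distinct) elements of $I$ are equal mod $p$, and at least two (distinct) elements of $J$ are equal mod $p$.
   Context: $\mathbb{Z}_n$ is the cyclic group of order $n$, identified with $\{0,1,\dots,n-1\}$, and $\binom{\mathbb{Z}_n}{d}$ denotes its set of $d$-element subsets. Fix a primitive $n$-th root of unity $\zeta\in\mathbb{C}$. For $I=\{i_1,\dots,i_d\}\in\binom{\mathbb{Z}_n}{d}$, the $I$-th representation of $\mathbb{Z}_n$ is the $d$-dimensional subrepresentation of the regular representation $\mathbb{C}[\mathbb{Z}_n]$ given by the row span of the $d\times n$ matrix whose entry in row $a\in\{1,\dots,d\}$ and column $j\in\{0,\dots,n-1\}$ is $\zeta^{j i_a}$. For $J\in\binom{\mathbb{Z}_n}{d}$, its $J$-th Plücker coordinate is the $d\times d$ minor of this matrix with columns indexed by $J$ (well-defined up to sign). Here $n=p^r$. *)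

(* Defs.v *)
From mathcomp Require Import all_boot all_order all_algebra.

Set Implicit Arguments.
Unset Strict Implicit.
Unset Printing Implicit Defensive.

Import GRing.Theory.
Local Open Scope ring_scope.

(* The a-th smallest element of a d-element subset of {0, ..., n-1}.         *)
Definition elt_of (n d : nat) (I : {set 'I_n}) (cardI : #|I| = d) (a : 'I_d) :
  'I_n := enum_val (cast_ord (esym cardI) a).

(* The I-th representation of Z_n is the row span of this matrix.  A Plücker *)
(* coordinate is the minor of a chosen spanning matrix, so the matrix itself *)
(* is kept rather than only its row space.                                   *)
Definition rep_mx (K : nzRingType) (n d : nat) (zeta : K) (I : {set 'I_n})
  (cardI : #|I| = d) : 'M[K]_(d, n) :=
  \matrix_(a < d, j < n) zeta ^+ (j * elt_of cardI a).

(* Columns are taken in increasing order, which fixes the sign.              *)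
Definition plucker (K : comNzRingType) (n d : nat) (M : 'M[K]_(d, n))
  (J : {set 'I_n}) (cardJ : #|J| = d) : K :=
  \det (colsub (elt_of cardJ) M).

(* Main.v *)
Require Import Defs.
From mathcomp Require Import all_boot all_order all_algebra.
From mathcomp Require Import reals complex ring.

(** Let the residues mod p of the m_b be distinct and put x_a = zeta^(j_a).
    Newton interpolation at the nodes x_l reads
      x_a^m = sum_k c_k(m) prod_(l < k) (x_a - x_l),
    so the minor det (x_a^(m_b)) is a nonzero triangular determinant times
    det (c_k(m_b)), and the latter is E(zeta) for an integer polynomial E.  If
    E(zeta) = 0 then E has a nonconstant common divisor with X^(p^r) - 1 in
    Z[X], and the latter is (X - 1)^(p^r) mod p, so p divides E(1).  But E(1)
    is det (binomial(m_b, k)), a factor of the Vandermonde determinant of the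
    m_b, which is nonzero mod p.  Exchanging the roles of rows and columns
    gives the two halves of the theorem. *)

Import GRing.Theory Num.Theory.
Local Open Scope ring_scope.

(* The divided difference of X^m at the nodes x_0, ..., x_k. *)
Fixpoint newton_coef (K : nzRingType) (x : nat -> K) (m k : nat) : K :=
  if m is m'.+1
  then x k * newton_coef K x m' k + (if k is k'.+1 then newton_coef K x m' k' else 0)
  else (k == 0)%:R.

Arguments newton_coef {K}.

Lemma newton_coef_gt (K : nzRingType) (x : nat -> K) (m k : nat) :
  (m < k)%N -> newton_coef x m k = 0.
Proof.
elim: m k => [|m IHm] [|k] //= ltmk.
by rewrite !IHm ?mulr0 ?addr0 // ltnW.
Qed.

Lemma eq_newton_coef (K : nzRingType) (x y : nat -> K) (m k : nat) :
  x =1 y -> newton_coef x m k = newton_coef y m k.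
Proof. by move=> xy; elim: m k => [|m IHm] [|k] //=; rewrite xy !IHm. Qed.

(** With all nodes equal to 1 the recursion becomes Pascal's rule. *)
Lemma newton_coef1 (K : nzRingType) (m k : nat) :
  newton_coef (fun=> 1 : K) m k = 'C(m, k)%:R.
Proof.
elim: m k => [|m IHm] [|k] //=; rewrite !IHm mul1r ?addr0 ?bin0 //.
by rewrite binS natrD.
Qed.

Lemma rmorph_newton_coef (K L : nzRingType) (f : {rmorphism K -> L})
    (x : nat -> K) (m k : nat) :
  f (newton_coef x m k) = newton_coef (f \o x) m k.
Proof.
elim: m k => [|m IHm] [|k] /=; rewrite ?rmorph_nat //.
  by rewrite rmorphD rmorphM rmorph0 IHm.
by rewrite rmorphD rmorphM !IHm.
Qed.

(** The disjunction lists two ways for the interpolation remainder to vanish: the degree is below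
    the number of nodes, or the full node product is zero at [y]. *)
Lemma expr_newton (K : comNzRingType) (x : nat -> K) (y : K) (m N : nat) :
  (m < N)%N || (\prod_(l < N) (y - x l) == 0) ->
  y ^+ m = \sum_(k < N) newton_coef x m k * \prod_(l < k) (y - x l).
Proof.
case: N => [|N]; first by rewrite big_ord0 oner_eq0.
elim: m => [_|m IHm ltmN].
  rewrite big_ord_recl big_ord0 mulr1 big1 ?addr0 // => i _.
  by rewrite mul0r.
rewrite exprSr IHm; last by case/orP: ltmN => [/ltnW->|->] //; rewrite orbT.
have top: newton_coef x m N * \prod_(l < N.+1) (y - x l) = 0.
  case/orP: ltmN => [ltmN|/eqP->]; last by rewrite mulr0.
  by rewrite newton_coef_gt ?mul0r.
rewrite mulr_suml /=.
under [RHS]eq_bigr do rewrite mulrDl.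
rewrite big_split /= [X in _ = _ + X]big_ord_recl mul0r add0r.
(* After the index shift, [top] supplies the missing last term; the sums then agree termwise by y =
   x_k + (y - x_k). *)
pose b k := newton_coef x m k * \prod_(l < k.+1) (y - x l).
rewrite (_ : \sum_(i < N) _ = \sum_(k < N.+1) b k); last first.
  by rewrite big_ord_recr /= [b N]top addr0.
rewrite -big_split; apply: eq_bigr => k _ /=.
rewrite /b big_ord_recr /=; set P := \prod_(l < k) _.
by ring.
Qed.

Lemma natr_ffact (K : comNzRingType) (n k : nat) :
  (n ^_ k)%:R = \prod_(l < k) (n%:R - l%:R) :> K.
Proof.
elim: k => [|k IHk]; first by rewrite big_ord0.
rewrite big_ord_recr /= -IHk ffactnSr natrM.
have [le_kn|lt_nk] := leqP k n; first by rewrite natrB.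
by rewrite ffact_small ?mul0r.
Qed.

Lemma det_Vandermonde_neq0 (K : idomainType) (d : nat) (a : 'rV[K]_d) :
  injective (a 0) -> \det (Vandermonde d a) != 0.
Proof.
move=> inj_a; rewrite det_Vandermonde; apply/prodf_neq0 => i _.
apply/prodf_neq0 => j lt_ij; rewrite subr_eq0 (inj_eq inj_a).
by rewrite neq_ltn lt_ij orbT.
Qed.

(** Interpolation at the nodes 0, 1, 2, ... writes powers of m_b in falling factorials k! *
    binomial(m_b, k), so this matrix is a right factor of a Vandermonde matrix. *)
Lemma det_binomial_neq0 (K : idomainType) (d : nat) (m : 'I_d -> nat) :
  injective (fun b => (m b)%:R : K) ->
  \det (\matrix_(k < d, b < d) 'C(m b, k)%:R : 'M[K]_d) != 0.
Proof.
move=> inj_m; set B := \matrix_(k, b) _.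
pose a : 'rV[K]_d := \row_b (m b)%:R.
pose C := \matrix_(i < d, k < d) (newton_coef (fun l => l%:R : K) i k * k`!%:R).
have VE : Vandermonde d a = C *m B.
  apply/matrixP=> i b; rewrite !mxE (@expr_newton _ (fun l => l%:R) _ _ d).
    apply: eq_bigr => k _.
    by rewrite !mxE -mulrA -natrM mulnC bin_ffact natr_ffact.
  by rewrite ltn_ord.
have : \det (Vandermonde d a) != 0.
  by apply: det_Vandermonde_neq0 => b b'; rewrite !mxE => /inj_m.
by rewrite VE det_mulmx mulf_eq0 negb_or => /andP[].
Qed.

Lemma det_newton_coef_eq0 (K : idomainType) (d : nat) (x : nat -> K)
    (m : 'I_d -> nat) :
  injective (fun a : 'I_d => x a) ->
  \det (\matrix_(a < d, b < d) x a ^+ m b) = 0 ->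
  \det (\matrix_(k < d, b < d) newton_coef x (m b) k) = 0.
Proof.
move=> inj_x; set A := \matrix_(a, b) _; set C := \matrix_(k, b) _.
pose W := \matrix_(a < d, k < d) \prod_(l < k) (x a - x l).
have -> : A = W *m C.
  apply/matrixP=> a b; rewrite !mxE (@expr_newton _ x _ _ d).
    by apply: eq_bigr => k _; rewrite !mxE mulrC.
  by rewrite (bigD1 a) //= subrr mul0r eqxx orbT.
(* Above the diagonal the product contains the factor x_a - x_a; on it, only differences of distinct
   nodes. *)
have trigW : is_trig_mx W.
  apply/is_trig_mxP => a k lt_ak.
  by rewrite mxE (bigD1 (Ordinal lt_ak)) //= subrr mul0r.
move/eqP; rewrite det_mulmx mulf_eq0 => /orP[|/eqP//].
rewrite det_trig // => /negPn/negP[]; apply/prodf_neq0 => a _; rewrite mxE.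
apply/prodf_neq0 => l _; rewrite subr_eq0; apply/eqP.
have ltld : (l < d)%N by apply: ltn_trans (ltn_ord a).
move=> /(inj_x a (Ordinal ltld)) al.
by have := ltn_ord l; rewrite {2}al ltnn.
Qed.

Lemma root1_mod_prime (K : numDomainType) (p r : nat) (zeta : K)
    (E : {poly int}) :
  prime p -> zeta ^+ (p ^ r) = 1 -> root (map_poly intr E) zeta ->
  root (map_poly intr E : {poly 'F_p}) 1.
Proof.
move=> p_pr zeta1 Ezeta; set n := (p ^ r)%N in zeta1.
have n_gt0 : (0 < n)%N by rewrite expn_gt0 prime_gt0.
pose g := gcdp E ('X^n - 1).
have Xn_neq0 : 'X^n - 1 != 0 :> {poly int}.
  by rewrite -size_poly_gt0 size_XnsubC.
(* Otherwise a Bezout combination of [E] and X^n - 1 is a nonzero integer constant, yet it vanishes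
   at [zeta]. *)
have g_size : (1 < size g)%N.
  rewrite ltn_neqAle size_poly_gt0 gcdp_eq0 (negPf Xn_neq0) andbF andbT eq_sym.
  apply/negP => /Bezout_coprimepP[[u v]] /= /eqp_size.
  rewrite size_poly1 => /eqP/size_poly1P[c c_neq0 uvE].
  have /(congr1 (horner^~ zeta)) := congr1 (map_poly (intr : int -> K)) uvE.
  rewrite map_polyC rmorphD !rmorphM rmorphB /= map_polyXn rmorph1.
  rewrite !hornerE (rootP Ezeta) zeta1 subrr !mulr0 addr0 => /esym/eqP.
  by rewrite intr_eq0 (negPf c_neq0).
(* By Gauss's lemma the primitive part of [g] divides both polynomials over the integers. *)
have [s Es] := dvdpP_int (dvdp_gcdl E ('X^n - 1)).
have [t Xt] := dvdpP_int (dvdp_gcdr E ('X^n - 1)).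
rewrite -/g in Es Xt; set h := zprimitive g in Es Xt.
pose red : {poly int} -> {poly 'F_p} := map_poly intr.
(* Dividing a monic polynomial, [h] has a unit as leading coefficient, so reduction mod p keeps its
   degree. *)
have h_lead : lead_coef h * lead_coef t = 1.
  by rewrite -lead_coefM -Xt lead_coefXnsubC.
have size_h : size (red h) = size h.
  apply: size_map_poly_id0; apply/negP => /eqP lead0.
  have /eqP := congr1 (intr : int -> 'F_p) h_lead.
  by rewrite rmorphM /= lead0 mul0r rmorph1 eq_sym oner_eq0.
have pcharX : p \in [pchar {poly 'F_p}].
  exact: (rmorph_pchar polyC (pchar_Fp p_pr)).
have Xp : red ('X^n - 1) = ('X - 1%:P) ^+ n.
  rewrite /red rmorphB /= map_polyXn rmorph1 exprDn_pchar ?pnatX ?pnatE ?pcharX //.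
  by rewrite exprNn_pchar ?pnatX ?pnatE ?pcharX // -rmorphXn /= expr1n.
(* Hence [red h] is associate to a power of X - 1, and its degree rules out exponent 0. *)
have /dvdp_exp_XsubCP[[|k] _ hk] : red h %| ('X - 1%:P) ^+ n.
- by rewrite -Xp Xt /red rmorphM dvdp_mulr.
- by move: g_size; rewrite -size_zprimitive -size_h (eqp_size hk) size_poly1.
by rewrite Es rmorphM rootM (eqp_root hk) root_exp_XsubC eqxx.
Qed.

Lemma det_root_unity_neq0 (K : numDomainType) (p r d : nat) (zeta : K)
    (j m : 'I_d -> nat) :
  prime p -> zeta ^+ (p ^ r) = 1 ->
  injective (fun a => zeta ^+ j a) -> injective (fun b => m b %% p)%N ->
  \det (\matrix_(a < d, b < d) zeta ^+ (j a * m b)) != 0.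
Proof.
move=> p_pr zeta1 inj_j inj_m; apply/eqP => det0.
(* The default 0 is harmless: the k-th coefficient involves only nodes of index at most k < d. *)
pose jn l := oapp j 0 (insub l).
have jnE (a : 'I_d) : jn a = j a by rewrite /jn valK.
(* Taking powers of X as nodes lets one integer polynomial specialize both to [zeta] in [K] and to 1
   in 'F_p. *)
pose E : {poly int} :=
  \det (\matrix_(k < d, b < d) newton_coef (fun l => 'X^(jn l)) (m b) k).
have evalE (L : comNzRingType) (y : L) : (map_poly intr E).[y] =
    \det (\matrix_(k < d, b < d) newton_coef (fun l => y ^+ jn l) (m b) k).
  rewrite -horner_evalE -!det_map_mx; congr (\det _).
  apply/matrixP => k b; rewrite !mxE !rmorph_newton_coef.
  apply: eq_newton_coef => l /=; by rewrite map_polyXn horner_evalE hornerXn.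
have Ezeta : root (map_poly intr E) zeta.
  rewrite /root evalE; apply/eqP/(@det_newton_coef_eq0 _ _ (fun l => zeta ^+ jn l)).
    by move=> a a'; rewrite !jnE => /inj_j.
  rewrite -[RHS]det0; congr (\det _); apply/matrixP=> a b.
  by rewrite !mxE exprM jnE.
have := root1_mod_prime _ p r zeta E p_pr zeta1 Ezeta.
rewrite /root evalE => /negPn/negP[].
rewrite [X in \det X](_ : _ = \matrix_(k < d, b < d) 'C(m b, k)%:R).
  apply: det_binomial_neq0 => b b' /(congr1 val) /=.
  by rewrite !val_Fp_nat // => /inj_m.
apply/matrixP => k b; rewrite !mxE -newton_coef1.
by apply: eq_newton_coef => l; rewrite expr1n.
Qed.

Lemma elt_of_inj (n d : nat) (S : {set 'I_n}) (cardS : #|S| = d) :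
  injective (elt_of cardS).
Proof. by move=> a b /enum_val_inj/cast_ord_inj. Qed.

Lemma congruent_elements (n p d : nat) (S : {set 'I_n}) (cardS : #|S| = d) :
  ~ injective (fun a => elt_of cardS a %% p)%N ->
  exists i i' : 'I_n,
    [/\ i \in S, i' \in S, i != i' & (i = i' %[mod p])%N].
Proof.
move=> /injectiveP/injectivePn[a [b neq_ab eq_ab]].
exists (elt_of cardS a), (elt_of cardS b); split=> //; try exact: enum_valP.
by apply: contraNneq neq_ab => /elt_of_inj ->.
Qed.

Theorem theorem4p1p9 (R : realType) (p r d : nat) (zeta : R[i])
  (I J : {set 'I_(p ^ r)}) (cardI : #|I| = d) (cardJ : #|J| = d) :
  prime p -> (1 <= r)%N -> (1 <= d <= p ^ r)%N ->
  (p ^ r)%N.-primitive_root zeta ->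
  plucker (rep_mx zeta cardI) cardJ = 0 ->
  (exists i i' : 'I_(p ^ r),
     [/\ i \in I, i' \in I, i != i' & (i = i' %[mod p])%N]) /\
  (exists j j' : 'I_(p ^ r),
     [/\ j \in J, j' \in J, j != j' & (j = j' %[mod p])%N]).
Proof.
move=> p_pr _ _ zetaP minor0.
have zeta1 := prim_expr_order zetaP.
have inj_zeta (S : {set 'I_(p ^ r)}) (cardS : #|S| = d) :
    injective (fun a => zeta ^+ elt_of cardS a).
  move=> a b /eqP; rewrite (eq_prim_root_expr zetaP) !modn_small //.
  by move=> /eqP/val_inj/elt_of_inj.
split.
  (* Here [J] provides the nodes and [I] the exponents, hence the transposition; the other half
     swaps these roles. *)
  apply: (congruent_elements _ _ _ _ cardI) => inj_mod.
  have /eqP[] := det_root_unity_neq0 _ _ _ _ _ _ _ p_pr zeta1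
    (inj_zeta J cardJ) inj_mod.
  rewrite -[RHS]minor0 /plucker -det_tr; congr (\det _).
  by apply/matrixP => a c; rewrite !mxE.
apply: (congruent_elements _ _ _ _ cardJ) => inj_mod.
have /eqP[] := det_root_unity_neq0 _ _ _ _ _ _ _ p_pr zeta1
  (inj_zeta I cardI) inj_mod.
rewrite -[RHS]minor0 /plucker; congr (\det _).
by apply/matrixP => a c; rewrite !mxE mulnC.
Qed.
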